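(* Let $(R,\mathfrak m)$ be a Noetherian local ring of dimension $d\ge1$ with infinite residue field and $\operatorname{depth}R\ge d-1$. Let $I$ be an $\mathfrak m$-primary ideal with minimal reduction $Q=(x_1,\dots,x_d)$, where $x_1,\dots,x_d$ is a superficial sequence of $I$. Then for $1\le i\le d$, $$e_i(I)=\sum_{n=i-1}^{\infty}\binom{n}{i-1}\bigl[\lambda(l_{Q,I}(n))+w_n(Q,I)-\lambda(U_I(d;n))\bigr].$$
   Context: $\lambda(-)$ denotes length; $I^n=R$ for $n\le0$. The Hilbert coefficients $e_0(I),\dots,e_d(I)$ are the integers with $\lambda(R/I^n)=\sum_{i=0}^d(-1)^ie_i(I)\binom{n+d-1-i}{d-i}$ for all $n\gg0$. An ideal $Q\subseteq I$ is a reduction of $I$ if $QI^n=I^{n+1}$ for some $n$; a minimal reduction is one minimal under inclusion among reductions of $I$. An element $x\in I\setminus I^2$ is superficial for $I$ if there is $c>0$ with $(I^{n+1}:x)\cap I^c=I^n$ for all $n\ge c$; $x_1,\dots,x_j$ is a superficial sequence of $I$ if $x_1$ is superficial for $I$ and the image of $x_i$ is superficial for the image of $I$ in $R/(x_1,\dots,x_{i-1})$ for $2\le i\le j$. Set $l_{Q,I}(n)=I^{n+1}/QI^n$ and $$U_I(d;n)=\frac{((x_1,\dots,x_{d-1}):x_d)\cap(I^n+(x_1,\dots,x_{d-1}))}{(x_1,\dots,x_{d-1})},$$ where $(x_1,\dots,x_{d-1})=(0)$ if $d=1$, so that $U_I(1;n)=(0:x_1)\cap I^n$. For $f:\mathbb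 Z\to\mathbb Z$ put $\Delta[f(n+1)]=f(n+1)-f(n)$ and $\Delta^i[f(n+1)]=\Delta^{i-1}[\Delta[f(n+1)]]$ (so $(\Delta f)(m)=f(m)-f(m-1)$). With $Q_i=(x_1,\dots,x_i)$, $Q_0=(0)$, define $w_n(Q,I)=0$ if $d=1$, and for $d\ge2$ $$w_n(Q,I)=\sum_{i=0}^{d-2}\left\{\Delta^{d-1-i}\left[\lambda\left(\frac{(I^{n+1}+Q_i):x_{i+1}}{I^n+Q_i}\right)\right]-\lambda\left(\frac{(I^{n+1}+Q_i):x_{i+1}}{(QI^n+Q_i):x_{i+1}}\right)\right\},$$ where the bracketed length is regarded as the value $f(n+1)$ of the function $f(m)=\lambda\bigl(((I^{m}+Q_i):x_{i+1})/(I^{m-1}+Q_i)\bigr)$. One has $w_n(Q,I)=0$ for $n\gg0$. *)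

(* Defs.v *)
From HB Require Import structures.
From mathcomp Require Import all_boot all_order all_algebra.
From mathcomp Require Import boolp classical_sets functions cardinality.

Set Implicit Arguments.
Unset Strict Implicit.
Unset Printing Implicit Defensive.

Import GRing.Theory.
Local Open Scope classical_set_scope.
Local Open Scope ring_scope.

(* Ideals are sets of ring elements, not the boolean proper ideals [idealr] of
   ring_quotient: the unit ideal must be allowed and membership need not be
   decidable. *)
Definition is_ideal (R : comNzRingType) (J : set R) : Prop :=
  [/\ J 0, forall a b, J a -> J b -> J (a + b) & forall a b, J b -> J (a * b)].

Definition ideal_gen (R : comNzRingType) (A : set R) : set R :=
  smallest (@is_ideal R) A.

Definition ideal_span (R : comNzRingType) (s : seq R) : set R :=
  ideal_gen [set` s].

Definition ideal_add (R : comNzRingType) (J K : set R) : set R :=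
  [set a + b | a in J & b in K].

Definition ideal_mul (R : comNzRingType) (J K : set R) : set R :=
  ideal_gen [set a * b | a in J & b in K].

(* J ^ n, with J ^ n = R for n <= 0 *)
Definition ideal_pow (R : comNzRingType) (J : set R) (n : int) : set R :=
  if n is Posz k then iter k (ideal_mul J) [set: R] else [set: R].

(* J : x *)
Definition colon (R : comNzRingType) (J : set R) (x : R) : set R :=
  [set a | J (a * x)].

Definition radical (R : comNzRingType) (J : set R) : set R :=
  [set a | exists k : nat, J (a ^+ k)].

Definition prime_ideal (R : comNzRingType) (P : set R) : Prop :=
  [/\ is_ideal P, ~ P 1 & forall a b, P (a * b) -> P a \/ P b].

Definition maximal_ideal (R : comNzRingType) (M : set R) : Prop :=
  [/\ is_ideal M, ~ M 1 &
      forall J, is_ideal J -> M `<=` J -> ~ J 1 -> J = M].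

Definition primary_ideal (R : comNzRingType) (J : set R) : Prop :=
  [/\ is_ideal J, ~ J 1 & forall a b, J (a * b) -> J a \/ radical J b].

Definition m_primary (R : comNzRingType) (M J : set R) : Prop :=
  primary_ideal J /\ radical J = M.

Definition noetherian (R : comNzRingType) : Prop :=
  forall J : set R, is_ideal J -> exists s : seq R, J = ideal_span s.

Definition local_ring (R : comNzRingType) (M : set R) : Prop :=
  maximal_ideal M /\ forall N, maximal_ideal N -> N = M.

Definition prime_chain (R : comNzRingType) (n : nat) : Prop :=
  exists P : nat -> set R,
    (forall i, (i <= n)%N -> prime_ideal (P i)) /\
    (forall i, (i < n)%N -> P i `<` P i.+1).

Definition is_krull_dim (R : comNzRingType) (n : nat) : Prop :=
  prime_chain R n /\ forall k, prime_chain R k -> (k <= n)%N.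

Definition regular_seq (R : comNzRingType) (M : set R) (s : seq R) : Prop :=
  (forall a, a \in s -> M a) /\
  (forall i, (i < size s)%N ->
     forall a, ideal_span (take i s) (a * s`_i) -> ideal_span (take i s) a).

(* the depth of a local ring with maximal ideal M *)
Definition is_depth (R : comNzRingType) (M : set R) (n : nat) : Prop :=
  (exists2 s : seq R, regular_seq M s & size s = n) /\
  forall s : seq R, regular_seq M s -> (size s <= n)%N.

(* [idealr R] only contains proper ideals.  When J is proper, some K : idealr R
   satisfies [set` K] = J, and any two such K define the same predicate: the
   existentials here and in [superficial_mod] merely give access to R / J. *)
Definition infinite_residue_field (R : comNzRingType) (M : set R) : Prop :=
  exists K : idealr R, [set` K] = M /\ infinite_set [set: {ideal_quot K}].

Definition reduction (R : comNzRingType) (I J : set R) : Prop :=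
  [/\ is_ideal J, J `<=` I &
      exists n : nat, ideal_mul J (ideal_pow I n) = ideal_pow I n.+1].

Definition minimal_reduction (R : comNzRingType) (I J : set R) : Prop :=
  reduction I J /\ forall J', reduction I J' -> J' `<=` J -> J' = J.

Definition superficial (R : comNzRingType) (I : set R) (x : R) : Prop :=
  [/\ I x, ~ ideal_pow I 2%N x &
      exists2 c : nat, (0 < c)%N & forall n : nat, (c <= n)%N ->
        colon (ideal_pow I n.+1) x `&` ideal_pow I c = ideal_pow I n].

(* the image of x is superficial for the image of I in R / J, J proper *)
Definition superficial_mod (R : comNzRingType) (J I : set R) (x : R) : Prop :=
  exists K : idealr R, [set` K] = J /\
    superficial ((\pi_({ideal_quot K})%qT : R -> {ideal_quot K}) @` I)
                (\pi_({ideal_quot K})%qT x).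

Definition superficial_seq (R : comNzRingType) (I : set R) (s : seq R) : Prop :=
  ((0 < size s)%N -> superficial I s`_0) /\
  (forall i, (0 < i < size s)%N ->
     superficial_mod (ideal_span (take i s)) I s`_i).

(* For ideals K `<=` J, the submodules of J / K are the L / K with L an ideal
   between K and J, so [is_length J K n] says that the R-module J / K has
   length n. *)
Definition ideal_chain (R : comNzRingType) (J K : set R) (n : nat) : Prop :=
  exists L : nat -> set R,
    (forall i, (i <= n)%N -> [/\ is_ideal (L i), K `<=` L i & L i `<=` J]) /\
    (forall i, (i < n)%N -> L i `<` L i.+1).

Definition is_length (R : comNzRingType) (J K : set R) (n : nat) : Prop :=
  ideal_chain J K n /\ forall k, ideal_chain J K k -> (k <= n)%N.

(* The length of J / K when it is finite, the junk value 0 otherwise. *)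
Definition len (R : comNzRingType) (J K : set R) : nat :=
  xget 0%N (is_length J K).

(* The subtractions inside the binomial coefficient are in nat; they are exact
   for n >= 1. *)
Definition hilbert_coefficients (R : comNzRingType) (I : set R) (d : nat)
    (e : nat -> int) : Prop :=
  exists N : nat, forall n : nat, (N <= n)%N ->
    (len [set: R] (ideal_pow I n))%:Z =
    \sum_(0 <= i < d.+1) (-1) ^+ i * e i * 'C(n + d - 1 - i, d - i)%:Z.

Definition backward_diff (f : int -> int) : int -> int :=
  fun k => f k - f (k - 1).

(* In what follows s is the sequence x_1, ..., x_d, so that s`_i is x_(i+1). *)

Definition l_len (R : comNzRingType) (I : set R) (s : seq R) (n : int) : nat :=
  len (ideal_pow I (n + 1)) (ideal_mul (ideal_span s) (ideal_pow I n)).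

Definition U_len (R : comNzRingType) (I : set R) (s : seq R) (n : int) : nat :=
  let Q' := ideal_span (take (size s).-1 s) in
  len (colon Q' s`_(size s).-1 `&` ideal_add (ideal_pow I n) Q') Q'.

Definition colon_len (R : comNzRingType) (I : set R) (s : seq R) (i : nat)
    (k : int) : int :=
  let Qi := ideal_span (take i s) in
  (len (colon (ideal_add (ideal_pow I k) Qi) s`_i)
       (ideal_add (ideal_pow I (k - 1)) Qi))%:Z.

Definition w (R : comNzRingType) (I : set R) (s : seq R) (n : int) : int :=
  \sum_(0 <= i < (size s).-1)
    let Qi := ideal_span (take i s) in
    (iter ((size s).-1 - i) backward_diff (colon_len I s i) (n + 1)
     - (len (colon (ideal_add (ideal_pow I (n + 1)) Qi) s`_i)
            (colon (ideal_add (ideal_mul (ideal_span s) (ideal_pow I n)) Qi)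
                   s`_i))%:Z).

(* \sum_(m <= n < oo) f n = v: convergence in the discrete group of integers *)
Definition int_series (m : nat) (f : nat -> int) (v : int) : Prop :=
  exists N : nat, forall k : nat, (N <= k)%N -> \sum_(m <= n < k) f n = v.

(* Main.v *)
(* Write A_i(m) = I^m + (x_1, ..., x_i).  Multiplication by x_{i+1} gives
   lambda(R / A_{i+1}(m)) = Delta lambda(R / A_i(m)) + lambda((A_i(m) : x_{i+1}) / A_i(m-1))
   and also relates the lengths of A_i(n+1) / (Q I^n + Q_i) for i and i + 1.
   Iterating up to i = d - 1, where the annihilator of x_d is responsible for the
   term U, yields an exact identity, for all n >= 0,
     lambda(l(n)) + w_n - lambda(U(n)) = C - Delta^d lambda(R / I^(n+1))
   with C independent of n.  For large n the left-hand side is 0, so C = e_0;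
   superficiality enters here, through the eventual constancy of the colon
   lengths, which are killed by Delta.  Summation by parts against the binomials
   then extracts e_i from the polynomial P(m) of which lambda(R / I^m) is the
   value for large m, because Delta^(d-i) P takes the value (-1)^i e_i at 0. *)
Require Import Defs.
From mathcomp Require Import all_boot all_order all_algebra.
From mathcomp Require Import boolp classical_sets.
From mathcomp Require Import zify ring.

Import GRing.Theory.
Local Open Scope ring_scope.

(** * Sums, products, powers and colons of ideals *)

Section Ideals.
Set Implicit Arguments.
Unset Strict Implicit.
Local Open Scope classical_set_scope.
Variable R : comNzRingType.
Implicit Types (A B C I J K L Q : set R) (a b x y : R) (s : seq R).

Lemma idealN J a : is_ideal J -> J a -> J (- a).
Proof. by case=> _ _ h ja; rewrite -mulN1r; exact: h. Qed.

Lemma idealB J a b : is_ideal J -> J a -> J b -> J (a - b).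
Proof. by move=> hJ ja jb; have [_ h _] := hJ; apply: h => //; exact: idealN. Qed.

Lemma idealT : is_ideal [set: R].
Proof. by []. Qed.

Lemma ideal_gen_ideal A : is_ideal (ideal_gen A).
Proof.
split=> [J [] [] //|a b ha hb J hJ|a b hb J hJ].
- have [[_ h _] _] := hJ; exact: h (ha _ hJ) (hb _ hJ).
- have [[_ _ h] _] := hJ; exact: h (hb _ hJ).
Qed.

Lemma ideal_gen_sub A : A `<=` ideal_gen A.
Proof. exact: sub_gen_smallest. Qed.

Lemma ideal_gen_min A J : is_ideal J -> A `<=` J -> ideal_gen A `<=` J.
Proof. exact: smallest_sub. Qed.

Lemma ideal_add_ideal J K : is_ideal J -> is_ideal K -> is_ideal (ideal_add J K).
Proof.
move=> [j0 jD jM] [k0 kD kM]; split.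
- by exists 0 => //; exists 0 => //; rewrite addr0.
- move=> _ _ [a ja [b kb <-]] [c jc [e ke <-]].
  exists (a + c); first exact: jD.
  by exists (b + e); [exact: kD | rewrite addrACA].
- move=> r _ [a ja [b kb <-]]; exists (r * a); first exact: jM.
  by exists (r * b); [exact: kM | rewrite mulrDr].
Qed.

Lemma ideal_addl J K : is_ideal K -> J `<=` ideal_add J K.
Proof. by case=> k0 _ _ a ja; exists a => //; exists 0 => //; rewrite addr0. Qed.

Lemma ideal_addr J K : is_ideal J -> K `<=` ideal_add J K.
Proof. by case=> j0 _ _ a ka; exists 0 => //; exists a => //; rewrite add0r. Qed.

Lemma ideal_add_min J K L :
  is_ideal L -> J `<=` L -> K `<=` L -> ideal_add J K `<=` L.
Proof. by case=> _ lD _ jL kL _ [a ja [b kb <-]]; apply: lD; [exact: jL|exact: kL]. Qed.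

Lemma ideal_addSl J J' K : J `<=` J' -> ideal_add J K `<=` ideal_add J' K.
Proof. by move=> h _ [a ja [b kb <-]]; exists a; [exact: h | exists b]. Qed.

Lemma ideal_addA J K L :
  ideal_add (ideal_add J K) L = ideal_add J (ideal_add K L).
Proof.
apply/seteqP; split=> z.
  move=> [_ [a ja [b kb <-]] [c lc <-]]; exists a => //.
  by exists (b + c); [exists b => //; exists c | rewrite addrA].
move=> [a ja [_ [b kb [c lc <-]] <-]]; exists (a + b).
  by exists a => //; exists b.
by exists c => //; rewrite addrA.
Qed.

Lemma ideal_addC J K : ideal_add J K = ideal_add K J.
Proof.
by apply/seteqP; split=> _ [a ja [b kb <-]];
  exists b => //; exists a => //; rewrite addrC.
Qed.

Lemma ideal_add_id J K : is_ideal J -> is_ideal K -> K `<=` J -> ideal_add J K = J.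
Proof.
move=> hJ hK s; apply/seteqP; split; last exact: ideal_addl.
exact: ideal_add_min.
Qed.

Lemma ideal_mul_ideal J K : is_ideal (ideal_mul J K).
Proof. exact: ideal_gen_ideal. Qed.

Lemma ideal_mul_in J K a b : J a -> K b -> ideal_mul J K (a * b).
Proof. by move=> ja kb; apply: ideal_gen_sub; exists a => //; exists b. Qed.

Lemma ideal_mul_min J K L :
  is_ideal L -> (forall a b, J a -> K b -> L (a * b)) -> ideal_mul J K `<=` L.
Proof. by move=> hL h; apply: ideal_gen_min => // _ [a ja [b kb <-]]; exact: h. Qed.

Lemma ideal_mulS J J' K K' :
  J `<=` J' -> K `<=` K' -> ideal_mul J K `<=` ideal_mul J' K'.
Proof.
move=> hJ hK; apply: ideal_mul_min; first exact: ideal_mul_ideal.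
by move=> a b ja kb; apply: ideal_mul_in; [exact: hJ | exact: hK].
Qed.

(** For fixed [a], the elements [b] with [a * b] in the target form an ideal, so both products can
    be tested on generators. This moves [Q] past [I] in [reduction_eventually]. *)
Lemma ideal_mulCA J K L : is_ideal L ->
  ideal_mul J (ideal_mul K L) `<=` ideal_mul K (ideal_mul J L).
Proof.
move=> hL; apply: ideal_mul_min; first exact: ideal_mul_ideal.
move=> a b ja; move: b.
apply: (@ideal_mul_min _ _ [set b | ideal_mul K (ideal_mul J L) (a * b)]).
  have [h0 hD hM] := ideal_mul_ideal K (ideal_mul J L); split=> /=.
  - by rewrite mulr0.
  - by move=> u v hu hv; rewrite mulrDr; exact: hD.
  - by move=> u v hv; rewrite mulrCA; exact: hM.
move=> b c kb lc /=; rewrite mulrCA; apply: ideal_mul_in => //.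
exact: ideal_mul_in.
Qed.

Lemma colon_ideal J x : is_ideal J -> is_ideal (colon J x).
Proof.
move=> [h0 hD hM]; split; rewrite /colon /=.
- by rewrite mul0r.
- by move=> a b ha hb; rewrite mulrDl; exact: hD.
- by move=> a b hb; rewrite -mulrA; exact: hM.
Qed.

Lemma colon_sub J x : is_ideal J -> J `<=` colon J x.
Proof. by case=> _ _ hM a ja; rewrite /colon /= mulrC; exact: hM. Qed.

Lemma colonS J K x : J `<=` K -> colon J x `<=` colon K x.
Proof. by move=> h a; exact: h. Qed.

(** The explicit multiples give a witness for every element, unlike a span defined as a smallest
    ideal. *)
Definition principal x : set R := [set a * x | a in [set: R]].

Lemma principal_ideal x : is_ideal (principal x).
Proof.
split.
- by exists 0 => //; rewrite mul0r.
- by move=> _ _ [a _ <-] [b _ <-]; exists (a + b) => //; rewrite mulrDl.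
- by move=> r _ [a _ <-]; exists (r * a) => //; rewrite mulrA.
Qed.

Lemma principal_id x : principal x x.
Proof. by exists 1 => //; rewrite mul1r. Qed.

Lemma principal_min x J : is_ideal J -> J x -> principal x `<=` J.
Proof. by case=> _ _ h jx _ [a _ <-]; exact: h. Qed.

Lemma ideal_span_ideal s : is_ideal (ideal_span s).
Proof. exact: ideal_gen_ideal. Qed.

Lemma ideal_span_in s a : a \in s -> ideal_span s a.
Proof. by move=> h; apply: ideal_gen_sub. Qed.

Lemma ideal_span_min s J :
  is_ideal J -> (forall a, a \in s -> J a) -> ideal_span s `<=` J.
Proof. by move=> hJ h; apply: ideal_gen_min. Qed.

Lemma ideal_span_nil : ideal_span [::] = [set 0 : R].
Proof.
apply/seteqP; split; last by move=> _ ->; have [] := ideal_span_ideal [::].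
apply: ideal_span_min => //; split=> // [a b -> ->|a b ->].
  by rewrite /= addr0.
by rewrite /= mulr0.
Qed.

Lemma ideal_span_rcons s x :
  ideal_span (rcons s x) = ideal_add (ideal_span s) (principal x).
Proof.
have hs := ideal_span_ideal s; have hx := principal_ideal x.
apply/seteqP; split.
  apply: ideal_span_min; first exact: ideal_add_ideal.
  move=> a; rewrite mem_rcons inE => /orP[/eqP->|h].
    by apply: ideal_addr => //; exact: principal_id.
  by apply: ideal_addl => //; exact: ideal_span_in.
apply: ideal_add_min; first exact: ideal_span_ideal.
  apply: ideal_span_min; first exact: ideal_span_ideal.
  by move=> a h; apply: ideal_span_in; rewrite mem_rcons inE h orbT.
apply: principal_min; first exact: ideal_span_ideal.
by apply: ideal_span_in; rewrite mem_rcons inE eqxx.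
Qed.

Lemma ideal_pow_ideal I (m : int) : is_ideal (ideal_pow I m).
Proof. by case: m => [[|n]|n] //=; exact: ideal_mul_ideal. Qed.

Lemma ideal_powS I (n : nat) : ideal_pow I n.+1 = ideal_mul I (ideal_pow I n).
Proof. by []. Qed.

Lemma ideal_pow_le0 I (m : int) : (m <= 0)%R -> ideal_pow I m = [set: R].
Proof. by case: m => [[|n]|n]. Qed.

Lemma ideal_powS_sub I (n : nat) : ideal_pow I n.+1 `<=` ideal_pow I n.
Proof.
apply: ideal_mul_min; first exact: ideal_pow_ideal.
by move=> a b _ h; have [_ _] := ideal_pow_ideal I n; exact.
Qed.

Lemma ideal_pow_anti I (m n : nat) :
  (m <= n)%N -> ideal_pow I n `<=` ideal_pow I m.
Proof.
move=> /subnK <-; elim: (n - m)%N => [//|k IH].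
by apply: subset_trans IH; exact: ideal_powS_sub.
Qed.

Lemma ideal_pow_mul_in I x a (m : int) :
  I x -> ideal_pow I (m - 1) a -> ideal_pow I m (a * x).
Proof.
case: m => [[|n]|n] // ix; have -> : Posz n.+1 - 1 = n by lia.
by move=> h; rewrite mulrC; exact: ideal_mul_in.
Qed.

Lemma ideal_pow_exp I a (n : nat) : I a -> ideal_pow I n (a ^+ n).
Proof.
by move=> ia; elim: n => [//|n IH]; rewrite exprS; exact: ideal_mul_in.
Qed.

End Ideals.

(** * Lengths by chains of ideals: additivity and isomorphism theorems *)

Section Length.
Set Implicit Arguments.
Unset Strict Implicit.
Local Open Scope classical_set_scope.
Variable R : comNzRingType.
Implicit Types (A B C I J K L : set R) (a b x y : R).

Definition finite_length J K : Prop := exists n, is_length J K n.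

Lemma ideal_chainS J J' K K' n : J `<=` J' -> K' `<=` K ->
  ideal_chain J K n -> ideal_chain J' K' n.
Proof.
move=> sJ sK [L [h1 h2]]; exists L; split=> // i /h1[hL hK hJ].
by split=> //; [exact: subset_trans hK | exact: subset_trans sJ].
Qed.

Lemma ideal_chain_rcons J K A n : is_ideal A -> J `<` A ->
  ideal_chain J K n -> ideal_chain A K n.+1.
Proof.
move=> hA [sJA nAJ] [L [h1 h2]].
exists (fun i => if (i <= n)%N then L i else A); split=> i hi.
  case: leqP => hin.
    by have [hL hK hJ] := h1 _ hin; split=> //; exact: subset_trans sJA.
  by have [_ hK hJ] := h1 0%N isT; split=> //; apply: subset_trans hK _; apply: subset_trans sJA.
case: (ltnP i n) => hin; first by rewrite ltnW //; exact: h2.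
rewrite -ltnS hi /=.
have [_ _ hJ] := h1 i hi; split; first exact: subset_trans sJA.
by move=> s; apply: nAJ; exact: subset_trans hJ.
Qed.

Lemma ideal_chain0 J K : is_ideal J -> K `<=` J -> ideal_chain J K 0.
Proof. by move=> hJ sKJ; exists (fun=> J); split=> // i _; split. Qed.

(** Deleting repetitions from a weakly increasing chain leaves a strict one, whose length counts the
    indices of genuine growth. *)
Lemma ideal_chain_steps K (L : nat -> set R) n :
  (forall i, (i <= n)%N -> is_ideal (L i)) -> K `<=` L 0%N ->
  (forall i, (i < n)%N -> L i `<=` L i.+1) ->
  ideal_chain (L n) K (\sum_(i < n) ~~ `[< L i.+1 `<=` L i >]).
Proof.
elim: n => [|n IH] hL hK hS.
  by rewrite big_ord0; apply: ideal_chain0 => //; exact: hL.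
have {}IH := IH (fun i h => hL i (leqW h)) hK (fun i h => hS i (leqW h)).
rewrite big_ord_recr /=; have s := hS n (leqnn _).
case: asboolP => h; first by rewrite addn0; apply: ideal_chainS IH.
by rewrite addn1; apply: ideal_chain_rcons IH => //; exact: hL.
Qed.

Lemma bounded_finite_length J K N : is_ideal J -> K `<=` J ->
  (forall k, ideal_chain J K k -> (k <= N)%N) -> finite_length J K.
Proof.
move=> hJ sKJ hN.
have ex : exists n, `[< ideal_chain J K n >].
  by exists 0%N; apply/asboolP; exact: ideal_chain0.
have ub n : `[< ideal_chain J K n >] -> (n <= N)%N by move=> /asboolP; exact: hN.
case: (ex_maxnP ex ub) => n /asboolP hn hmax; exists n; split=> // k hk.
by apply: hmax; apply/asboolP.
Qed.

Lemma len_is_length J K : finite_length J K -> is_length J K (len J K).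
Proof. exact: xgetPex. Qed.

Lemma is_length_len J K n : is_length J K n -> len J K = n.
Proof.
move=> h; have [h1 h2] := len_is_length (ex_intro _ n h).
by have [h3 h4] := h; apply/eqP; rewrite eqn_leq h4 // h2.
Qed.

Lemma finite_lengthS J K J' K' : is_ideal J' -> J' `<=` J -> K `<=` K' ->
  K' `<=` J' -> finite_length J K -> finite_length J' K'.
Proof.
move=> hJ' sJ sK s' [n [_ hn]]; apply: (@bounded_finite_length _ _ n) => // k hk.
by apply: hn; apply: ideal_chainS hk.
Qed.

Lemma ideal_chain_cat J L K m n :
  ideal_chain J L m -> ideal_chain L K n -> ideal_chain J K (n + m).
Proof.
move=> [A [hA sA]] [B [hB sB]].
have sJL : L `<=` J by have [_ h1 h2] := hA 0%N isT; exact: subset_trans h2.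
have sKL : K `<=` L by have [_ h1 h2] := hB 0%N isT; exact: subset_trans h2.
exists (fun i => if (i <= n)%N then B i else A (i - n)%N); split=> i hi.
  case: leqP => hin.
    by have [h1 h2 h3] := hB _ hin; split=> //; exact: subset_trans sJL.
  have [|h1 h2 h3] := hA (i - n)%N; first by rewrite leq_subLR.
  by split=> //; exact: subset_trans h2.
case: (ltngtP i n) => hin.
- exact: sB.
- by rewrite subSn ?(ltnW hin) //; apply: sA; lia.
- rewrite hin subSnn; have [_ _ s1] := hB n (leqnn n); have m0 : (0 < m)%N by lia.
  have [_ s2 _] := hA 0%N isT; have [s3 s4] := sA 0%N m0; split.
    by apply: subset_trans s1 _; apply: subset_trans s3.
  by move=> s; apply: s4; apply: subset_trans s _; exact: subset_trans s2.
Qed.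

(** The modular law: nested ideals with the same trace on [L] and the same sum with [L] are
    equal. *)
Lemma ideal_modular A B L : is_ideal A -> A `<=` B -> B `&` L `<=` A ->
  B `<=` ideal_add A L -> is_ideal B -> B `<=` A.
Proof.
move=> hA sAB sI sS hB b hb; have [a ha [l hl eb]] := sS _ hb.
have [_ hD _] := hA; rewrite -eb; apply: hD => //; apply: sI; split=> //.
have -> : l = b - a by rewrite -eb addrC addKr.
by apply: idealB => //; exact: sAB.
Qed.

Lemma setI_ideal A B : is_ideal A -> is_ideal B -> is_ideal (A `&` B).
Proof.
move=> [a0 aD aM] [b0 bD bM]; split=> // [a b [? ?] [? ?]|a b [? ?]].
  by split; [exact: aD | exact: bD].
by split; [exact: aM | exact: bM].
Qed.

(** Concatenating chains gives a chain of length [n + m]. Conversely, intersect a chain with [L] and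
    add [L] to it: by the modular law each strict step stays strict in at least one of the two, so
    [n + m] is also an upper bound. *)
Lemma is_length_add J L K m n : is_ideal J -> is_ideal L -> K `<=` L -> L `<=` J ->
  is_length J L m -> is_length L K n -> is_length J K (n + m).
Proof.
move=> hJ hL sKL sLJ [cm hm] [cn hn]; split; first exact: ideal_chain_cat cm cn.
move=> k [A [hA sA]].
have cI : ideal_chain L K (\sum_(i < k) ~~ `[< A i.+1 `&` L `<=` A i `&` L >]).
  apply: (@ideal_chainS (A k `&` L) _ K) => //.
  apply: (@ideal_chain_steps K (fun i => A i `&` L)) => i.
  - by move=> /hA[? _ _]; exact: setI_ideal.
  - by move=> h; split; [have [_ + _] := hA 0%N isT; exact | exact: sKL].
  - by move=> /sA[s _]; exact: setSI.
have cS : ideal_chain J L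
    (\sum_(i < k) ~~ `[< ideal_add (A i.+1) L `<=` ideal_add (A i) L >]).
  apply: (@ideal_chainS (ideal_add (A k) L) _ L) => //.
    by have [_ _ sJ] := hA k (leqnn k); exact: ideal_add_min.
  apply: (@ideal_chain_steps L (fun i => ideal_add (A i) L)) => i.
  - by move=> /hA[? _ _]; exact: ideal_add_ideal.
  - by move=> h; apply: ideal_addr => //; have [] := hA 0%N isT.
  - by move=> /sA[s _]; exact: ideal_addSl.
apply: leq_trans (leq_add (hn _ cI) (hm _ cS)); rewrite -big_split /=.
rewrite -[X in (X <= _)%N]card_ord -sum1_card; apply: leq_sum => i _.
case: asboolP => // s1; case: asboolP => // s2.
have [s ns] := sA i (ltn_ord i); have [h1 _ _] := hA i (ltnW (ltn_ord i)).
have [h2 _ _] := hA i.+1 (ltn_ord i).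
case: ns; apply: (@ideal_modular _ _ L) => //.
  by apply: subset_trans s1 _; exact: subIsetl.
by apply: subset_trans s2; exact: ideal_addl.
Qed.

(** A map that preserves and reflects inclusions carries strict chains to strict chains. Two such
    maps in opposite directions compare lengths without quotient modules. *)
Lemma ideal_chain_map (f : set R -> set R) J K J' K' n :
  (forall L, is_ideal L -> K `<=` L -> L `<=` J ->
     [/\ is_ideal (f L), K' `<=` f L & f L `<=` J']) ->
  (forall L1 L2, is_ideal L1 -> is_ideal L2 -> K `<=` L1 -> L1 `<=` L2 ->
     L2 `<=` J -> f L1 `<=` f L2 /\ (f L2 `<=` f L1 -> L2 `<=` L1)) ->
  ideal_chain J K n -> ideal_chain J' K' n.
Proof.
move=> h1 h2 [L [hL sL]]; exists (f \o L); split=> i hi /=.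
  by have [a b c] := hL i hi; exact: h1.
have [a b c] := hL i (ltnW hi); have [a' b' c'] := hL i.+1 hi.
have [s ns] := sL i hi; have [s1 s2] := h2 _ _ a a' b s c'.
by split=> // /s2.
Qed.

Lemma eq_is_length J K J' K' n :
  (forall k, ideal_chain J K k <-> ideal_chain J' K' k) ->
  is_length J K n <-> is_length J' K' n.
Proof.
by move=> h; split=> -[/h h1 h2]; split=> // k /h; exact: h2.
Qed.

(** The second isomorphism theorem, through [L] to [L] cap [A] one way and [L] to [L + B] the
    other. *)
Lemma is_length_setI A B n : is_ideal A -> is_ideal B ->
  is_length (ideal_add A B) B n <-> is_length A (A `&` B) n.
Proof.
move=> hA hB; apply: eq_is_length => k; split.
  apply: (ideal_chain_map (f := fun L => L `&` A)) => [L hL sB sL|L1 L2 h1 h2 sB sL s2].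
    split; [exact: setI_ideal | | exact: subIsetr].
    by move=> a [? ?]; split=> //; exact: sB.
  split; first exact: setSI.
  move=> s l hl; have [a ha [b hb e]] := s2 _ hl.
  have [_ hD _] := h1; rewrite -e; apply: hD; last exact: sB.
  suff [] : (L1 `&` A) a by [].
  apply: s; split=> //; have -> : a = l - b by rewrite -e addrK.
  by apply: idealB => //; apply: sL; exact: sB.
apply: (ideal_chain_map (f := fun L => ideal_add L B)) => [L hL sI sA|L1 L2 h1 h2 sI sL sA].
  by split; [exact: ideal_add_ideal | exact: ideal_addr | exact: ideal_addSl].
split; first exact: ideal_addSl.
move=> s l hl; have [a ha [b hb e]] := s _ (ideal_addl hB hl).
have [_ hD _] := h1; rewrite -e; apply: hD => //; apply: sI.
have eb : b = l - a by rewrite -e addrC addKr.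
split=> //; rewrite eb; apply: idealB => //; apply: sA => //; exact: sL.
Qed.

(** Multiplication by [x] induces R/(J : x) = (J + (x))/J. On ideals it is [L] to [J + L x], and the
    colon by [x] goes back. *)
Lemma is_length_colon J x n : is_ideal J ->
  is_length (ideal_add J (principal x)) J n <-> is_length [set: R] (colon J x) n.
Proof.
move=> hJ; have hx := principal_ideal x; apply: eq_is_length => k; split.
  apply: (ideal_chain_map (f := fun L => colon L x)) => [L hL sB sL|L1 L2 h1 h2 sB sL s2].
    by split=> //; [exact: colon_ideal | exact: colonS].
  split; first exact: colonS.
  move=> s l hl; have [j hj [_ [a _ <-] e]] := s2 _ hl.
  have [_ hD _] := h1; rewrite -e; apply: hD; first exact: sB.
  apply: (s a); rewrite /colon /=; have -> : a * x = l - j by rewrite -e addrC addKr.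
  by apply: idealB => //; apply: sL; exact: sB.
apply: (ideal_chain_map (f := fun L => ideal_add J [set a * x | a in L]))
  => [L hL sI sA|L1 L2 h1 h2 sI sL sA].
  have hxL : is_ideal [set a * x | a in L].
    have [l0 lD lM] := hL; split.
    - by exists 0 => //; rewrite mul0r.
    - by move=> _ _ [a ha <-] [b hb <-]; exists (a + b); [exact: lD | rewrite mulrDl].
    - by move=> r _ [a ha <-]; exists (r * a); [exact: lM | rewrite mulrA].
  split; [exact: ideal_add_ideal | exact: ideal_addl |].
  apply: ideal_add_min; [exact: ideal_add_ideal | exact: ideal_addl |].
  by move=> _ [a _ <-]; apply: ideal_addr => //; exists a.
split.
  move=> _ [j hj [_ [a ha <-] <-]]; exists j => //; exists (a * x) => //.
  by exists a => //; exact: sL.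
move=> s l hl.
have : ideal_add J [set a * x | a in L2] (l * x) by apply: ideal_addr => //; exists l.
move=> /s [j hj [_ [a ha <-] e]].
have [_ hD _] := h1; rewrite -(subrK a l); apply: hD => //; apply: sI.
by rewrite /colon /= mulrBl -e addrK.
Qed.

End Length.

(** * Length formulas, the ascending chain condition and finite length of R/J *)

Section FiniteLength.
Set Implicit Arguments.
Unset Strict Implicit.
Local Open Scope classical_set_scope.
Variable R : comNzRingType.
Implicit Types (A B C I J K L M : set R) (a b x y : R).

Lemma finite_length_add J L K : is_ideal J -> is_ideal L ->
  K `<=` L -> L `<=` J -> finite_length J L -> finite_length L K ->
  finite_length J K.
Proof.
by move=> hJ hL sKL sLJ [m hm] [n hn]; exists (n + m)%N; exact: is_length_add hm hn.
Qed.

Lemma len_add J L K : is_ideal J -> is_ideal L -> K `<=` L -> L `<=` J ->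
  finite_length J K -> len J K = (len J L + len L K)%N.
Proof.
move=> hJ hL sKL sLJ fin; apply: is_length_len; rewrite addnC.
apply: (@is_length_add R J L K) => //; apply: len_is_length.
  by apply: finite_lengthS fin.
by apply: finite_lengthS fin.
Qed.

Lemma len_id J : is_ideal J -> len J J = 0%N.
Proof.
move=> hJ; apply: is_length_len; split; first exact: ideal_chain0.
move=> k [L [h1 h2]]; case: k => // k in h1 h2 *.
have [_ _ s1] := h1 1%N isT; have [_ s2 _] := h1 0%N isT.
by have [_ []] := h2 0%N isT; exact: subset_trans s2.
Qed.

Lemma finite_length_id J : is_ideal J -> finite_length J J.
Proof.
move=> hJ; apply: (@bounded_finite_length R J J 0) => // k [L [h1 h2]].
case: k => // k in h1 h2 *.
have [_ _ s1] := h1 1%N isT; have [_ s2 _] := h1 0%N isT.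
by have [_ []] := h2 0%N isT; exact: subset_trans s2.
Qed.

Lemma len_setI A B : is_ideal A -> is_ideal B -> finite_length A (A `&` B) ->
  len (ideal_add A B) B = len A (A `&` B).
Proof.
by move=> hA hB fin; apply: is_length_len; apply/is_length_setI => //; exact: len_is_length.
Qed.

Lemma len_colon J x : is_ideal J -> finite_length [set: R] J ->
  len [set: R] J =
    (len [set: R] (ideal_add J (principal x)) + len [set: R] (colon J x))%N.
Proof.
move=> hJ fin; have hx := principal_ideal x.
have sJ : J `<=` ideal_add J (principal x) by exact: ideal_addl.
rewrite (@len_add _ (ideal_add J (principal x)) J) //; last exact: ideal_add_ideal.
congr addn; apply: is_length_len; apply/is_length_colon => //; apply: len_is_length.
by apply: finite_lengthS fin => //; exact: colon_sub.
Qed.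

(** The union is a finitely generated ideal, and some stage contains all its generators. *)
Lemma noetherian_acc (hR : noetherian R) (L : nat -> set R) :
  (forall n, is_ideal (L n)) -> (forall n, L n `<=` L n.+1) ->
  exists N, forall n, L n `<=` L N.
Proof.
move=> hL sL.
have mono m n : (m <= n)%N -> L m `<=` L n.
  move=> /subnK <-; elim: (n - m)%N => // k IH.
  by apply: subset_trans IH _; exact: sL.
have hU : is_ideal [set a | exists n, L n a].
  split.
  - by exists 0%N; have [] := hL 0%N.
  - move=> a b [m ha] [n hb]; exists (maxn m n); have [_ hD _] := hL (maxn m n).
    by apply: hD; [apply: mono ha; exact: leq_maxl | apply: mono hb; exact: leq_maxr].
  - by move=> a b [n hb]; exists n; have [_ _ hM] := hL n; exact: hM.
have [s es] := hR _ hU.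
suff [N hN] : exists N, forall a, a \in s -> L N a.
  exists N => n a ha; have : ideal_span s a by rewrite -es; exists n.
  by apply: ideal_span_min.
have : forall a, a \in s -> exists n, L n a.
  by move=> a /ideal_span_in; rewrite -es.
elim: (s) => [|b t IH] h; first by exists 0%N.
have [a ha|m hm] := IH; first by apply: h; rewrite inE ha orbT.
have [n hn] := h b (mem_head _ _); exists (maxn m n) => a; rewrite inE.
case/orP => [/eqP->|/hm]; first by apply: mono hn; exact: leq_maxr.
by apply: mono; exact: leq_maxl.
Qed.

(** Otherwise, choosing a strictly larger member again and again would contradict
    [noetherian_acc]. *)
Lemma noetherian_max (hR : noetherian R) (P : set (set R)) J :
  (forall K, P K -> is_ideal K) -> P J ->
  exists2 K, P K & forall L, P L -> K `<=` L -> L `<=` K.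
Proof.
move=> hP hJ; apply: contrapT => hn.
have /choice[f hf] : forall K, exists L, P K -> [/\ P L, K `<=` L & ~ L `<=` K].
  move=> K; case: (pselect (P K)) => hK; last by exists K.
  apply: contrapT => nL; apply: hn; exists K => // L hL sKL.
  by apply: contrapT => nLK; apply: nL; exists L.
have hi n : P (iter n f J) by elim: n => //= n /hf[].
have [n|n|N hN] := noetherian_acc hR (L := fun n => iter n f J).
- exact: hP.
- by have [] := hf _ (hi n).
- by have [_ _] := hf _ (hi N); apply; exact: hN N.+1.
Qed.

Lemma maximal_finite_length M : maximal_ideal M -> finite_length [set: R] M.
Proof.
move=> [hM M1 max]; apply: (@bounded_finite_length R _ _ 1) => // -[|[|k]] // [L [h1 h2]].
have [_ s0 _] := h1 0%N isT; have [hL1 s1 _] := h1 1%N isT.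
have [_ n0] := h2 0%N isT; have [_ n1] := h2 1%N isT.
case: n0; rewrite (max _ hL1 s1) // => L11; apply: n1 => a _.
by rewrite -[a]mulr1; have [_ _] := hL1; exact.
Qed.

(** Take [K] maximal among the ideals over [J] with K/J of finite length. If [K] were proper, some
    prime K : a would contain [J], hence [M], hence equal [M]; then (K + (a))/K = R/M has finite
    length and K + (a) contradicts the choice of [K]. *)
Lemma finite_length_primary (hR : noetherian R) M J : maximal_ideal M ->
  is_ideal J -> (forall b, M b -> exists k, J (b ^+ k)) ->
  finite_length [set: R] J.
Proof.
move=> hM hJ hrad.
have [||K [hK sJK fK] Kmax] := noetherian_max hR
    (P := [set K | [/\ is_ideal K, J `<=` K & finite_length K J]]) (J := J).
- by move=> K [].
- by split=> //; exact: finite_length_id.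
have [K1|K1] := pselect (K 1).
  suff -> : [set: R] = K by [].
  apply/seteqP; split=> // a _.
  by rewrite -[a]mulr1; have [_ _] := hK; exact.
(* A maximal colon ideal [K : a] with [a] outside [K] is prime. *)
have [||P [a nKa eP] Pmax] := noetherian_max hR
    (P := [set L | exists2 a, ~ K a & L = colon K a]) (J := colon K 1).
- by move=> L [a _ ->]; exact: colon_ideal.
- by exists 1.
have hP : is_ideal P by rewrite eP; exact: colon_ideal.
have P1 : ~ P 1 by rewrite eP /colon /= mul1r.
have prime b c : P (b * c) -> P b \/ P c.
  move=> hbc; case: (pselect (P c)) => hc; [by right | left].
  have nca : ~ K (c * a) by move: hc; rewrite eP.
  apply: (Pmax (colon K (c * a))); first by exists (c * a).
    rewrite eP => r; rewrite /colon /= => hr.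
    by rewrite mulrCA; have [_ _] := hK; exact.
  by move: hbc; rewrite eP /colon /= -mulrA.
have sJP : J `<=` P by rewrite eP; apply: subset_trans sJK _; exact: colon_sub.
have sMP : M `<=` P.
  (* A power of [b] lies in the prime [P], so [b] does; exponent 0 would put 1 in [P]. *)
  move=> b /hrad[k /sJP]; elim: k => [|k IH]; first by rewrite expr0.
  by rewrite exprS => /prime[].
have ePM : P = M by have [_ _] := hM; exact.
have fP : finite_length [set: R] P by rewrite ePM; exact: maximal_finite_length.
have ha := principal_ideal a.
have fKa : finite_length (ideal_add K (principal a)) K.
  have [n hn] := fP; exists n; apply/is_length_colon => //.
  by rewrite -eP.
case: nKa; apply: (Kmax (ideal_add K (principal a))).
- split; first exact: ideal_add_ideal.
    by apply: subset_trans sJK _; exact: ideal_addl.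
  apply: finite_length_add fKa fK => //; first exact: ideal_add_ideal.
  exact: ideal_addl.
- exact: ideal_addl.
- by apply: ideal_addr => //; exact: principal_id.
Qed.

End FiniteLength.

(** * Superficial elements pulled back along a surjection *)

Section Images.
Set Implicit Arguments.
Unset Strict Implicit.
Local Open Scope classical_set_scope.
Variables (R S : comNzRingType) (f : {rmorphism R -> S}).
Hypothesis f_surj : forall z, exists a, f a = z.
Implicit Types (A B I J : set R).

Lemma image_ideal A : is_ideal A -> is_ideal (f @` A).
Proof.
move=> [a0 aD aM]; split.
- by exists 0 => //; rewrite rmorph0.
- by move=> _ _ [a ha <-] [b hb <-]; exists (a + b); [exact: aD | rewrite rmorphD].
- move=> z _ [b hb <-]; have [a <-] := f_surj z.
  by exists (a * b); [exact: aM | rewrite rmorphM].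
Qed.

Lemma image_ideal_mul A B : f @` ideal_mul A B = ideal_mul (f @` A) (f @` B).
Proof.
apply/seteqP; split.
  suff h : ideal_mul A B `<=` f @^-1` ideal_mul (f @` A) (f @` B).
    by move=> _ [a /h ha <-].
  apply: ideal_mul_min.
    have [h0 hD hM] := ideal_mul_ideal (f @` A) (f @` B); split=> /=.
    - by rewrite rmorph0.
    - by move=> a b ha hb; rewrite rmorphD; exact: hD.
    - by move=> a b hb; rewrite rmorphM; exact: hM.
  by move=> a b ha hb /=; rewrite rmorphM; apply: ideal_mul_in; [exists a|exists b].
apply: ideal_mul_min; first by apply: image_ideal; exact: ideal_mul_ideal.
by move=> _ _ [a ha <-] [b hb <-]; exists (a * b); [exact: ideal_mul_in|rewrite rmorphM].
Qed.

Lemma image_ideal_pow I (n : nat) : f @` ideal_pow I n = ideal_pow (f @` I) n.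
Proof.
elim: n => [|n IH]; last by rewrite !ideal_powS image_ideal_mul IH.
by apply/seteqP; split=> // z _; have [a <-] := f_surj z; exists a.
Qed.

(** Membership of [f a] in a power of the image of [I] means membership of [a] in that power of [I]
    plus the kernel, so the defining equation lifts to [R]. *)
Lemma superficial_kernel J I x : (forall a, J a <-> f a = 0) ->
  superficial (f @` I) (f x) ->
  exists c : nat, forall n : nat, (c <= n)%N ->
    colon (ideal_add (ideal_pow I n.+1) J) x `&` ideal_add (ideal_pow I c) J
    = ideal_add (ideal_pow I n) J.
Proof.
move=> kerJ [_ _ [c _ h]]; exists c => n /h {}h.
have powP (m : nat) a : ideal_pow (f @` I) m (f a) <-> ideal_add (ideal_pow I m) J a.
  rewrite -image_ideal_pow; split=> [[b hb e]|[b hb [j /kerJ hj <-]]].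
    by exists b => //; exists (a - b); [apply/kerJ; rewrite rmorphB e subrr | rewrite addrC subrK].
  by exists b => //; rewrite rmorphD hj addr0.
apply/seteqP; split=> a.
  move=> [h1 h2]; apply/powP; rewrite -h; split; last by apply/powP.
  by rewrite /colon /= -rmorphM; apply/(powP n.+1).
move=> /powP; rewrite -h => -[h1 h2]; split; last by apply/powP.
by move: h1; rewrite /colon /= -rmorphM => /(powP n.+1).
Qed.

End Images.

(** * Colon lengths: stabilization, and one step of reduction modulo x *)

Section ColonLengths.
Set Implicit Arguments.
Unset Strict Implicit.
Local Open Scope classical_set_scope.
Variable R : comNzRingType.
Implicit Types (A B C I J K Q : set R) (a b x y : R).

(** The first element of the sequence, put in the form of the later ones by taking the identity as
    quotient map by the zero ideal. *)
Lemma superficial_colon I x : superficial I x ->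
  exists c : nat, forall n : nat, (c <= n)%N ->
    colon (ideal_add (ideal_pow I n.+1) [set 0]) x
      `&` ideal_add (ideal_pow I c) [set 0]
    = ideal_add (ideal_pow I n) [set 0].
Proof.
move=> h; apply: (@superficial_kernel R R idfun) => //; last by rewrite image_id.
by move=> z; exists z.
Qed.

Lemma superficial_mod_colon J I x : superficial_mod J I x ->
  exists c : nat, forall n : nat, (c <= n)%N ->
    colon (ideal_add (ideal_pow I n.+1) J) x `&` ideal_add (ideal_pow I c) J
    = ideal_add (ideal_pow I n) J.
Proof.
move=> [K [eJ h]].
apply: (@superficial_kernel R {ideal_quot K} (\pi_({ideal_quot K})%qT)) h.
- by move=> z; exists (repr z); exact: reprK.
- move=> a; rewrite -eJ /=; have -> : (a \in K) = (a - 0 \in K) by rewrite subr0.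
  by rewrite Quotient.idealrBE; split=> [/eqP->|e]; [rewrite rmorph0 | rewrite e rmorph0].
Qed.

Lemma nonincreasing_eventually_constant (u : nat -> nat) c :
  (forall m n, (c <= m)%N -> (m <= n)%N -> (u n <= u m)%N) ->
  exists N v, forall n, (N <= n)%N -> u n = v.
Proof.
move=> h; pose P v := `[< exists2 n, (c <= n)%N & u n = v >].
have ex : exists v, P v by exists (u c); apply/asboolP; exists c.
case: (ex_minnP ex) => v /asboolP[N cN <-] hv; exists N, (u N) => n Nn.
apply/eqP; rewrite eqn_leq h //=; apply: hv; apply/asboolP; exists n => //.
exact: leq_trans Nn.
Qed.

(** Write A(n) for I^n + J. Since (A(n+1) : x) meets A(c) in A(n), the length equals that of
    ((A(n+1) : x) + A(c))/A(c). These ideals decrease with [n], so the lengths are nonincreasing and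
    become constant. *)
Lemma superficial_colon_len I J x (c : nat) : is_ideal J ->
  finite_length [set: R] (ideal_add (ideal_pow I c) J) ->
  (forall n : nat, (c <= n)%N ->
    colon (ideal_add (ideal_pow I n.+1) J) x `&` ideal_add (ideal_pow I c) J
    = ideal_add (ideal_pow I n) J) ->
  exists N v, forall n : nat, (N <= n)%N ->
    len (colon (ideal_add (ideal_pow I n.+1) J) x) (ideal_add (ideal_pow I n) J) = v.
Proof.
move=> hJ fin hc; set Ac := ideal_add _ J in fin *.
have hA (m : nat) : is_ideal (ideal_add (ideal_pow I m) J).
  by apply: ideal_add_ideal => //; exact: ideal_pow_ideal.
pose D (n : nat) := colon (ideal_add (ideal_pow I n.+1) J) x.
have hD n : is_ideal (D n) by exact: colon_ideal.
have hDA n : is_ideal (ideal_add (D n) Ac) by apply: ideal_add_ideal => //; exact: hA.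
have fD n : finite_length (ideal_add (D n) Ac) Ac.
  by apply: finite_lengthS fin => //; apply: ideal_addr.
have anti m n : (c <= m)%N -> (m <= n)%N ->
    (len (ideal_add (D n) Ac) Ac <= len (ideal_add (D m) Ac) Ac)%N.
  move=> cm mn; have s : ideal_add (D n) Ac `<=` ideal_add (D m) Ac.
    by apply: ideal_addSl; apply: colonS; apply: ideal_addSl; exact: ideal_pow_anti.
  rewrite [X in (_ <= X)%N](@len_add R _ (ideal_add (D n) Ac)) ?leq_addl //.
  exact: ideal_addr.
have [N [v hv]] := nonincreasing_eventually_constant anti.
exists (maxn c N), v => n; rewrite geq_max => /andP[cn Nn].
rewrite -(hv n Nn) -(hc n cn); symmetry; apply: len_setI => //; first exact: hA.
by have [k hk] := fD n; exists k; apply/is_length_setI => //; exact: hA.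
Qed.

Lemma len_quotient_step I J x (m : int) : is_ideal J -> I x ->
  (forall k : int, finite_length [set: R] (ideal_add (ideal_pow I k) J)) ->
  (len [set: R] (ideal_add (ideal_pow I m) (ideal_add J (principal x))))%:Z =
  (len [set: R] (ideal_add (ideal_pow I m) J))%:Z
  - (len [set: R] (ideal_add (ideal_pow I (m - 1)) J))%:Z
  + (len (colon (ideal_add (ideal_pow I m) J) x)
         (ideal_add (ideal_pow I (m - 1)) J))%:Z.
Proof.
move=> hJ Ix fin; rewrite -ideal_addA.
have hA (k : int) : is_ideal (ideal_add (ideal_pow I k) J).
  by apply: ideal_add_ideal => //; exact: ideal_pow_ideal.
rewrite (@len_colon R _ x (hA m) (fin m)).
rewrite (@len_add R [set: R] (colon (ideal_add (ideal_pow I m) J) x)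
    (ideal_add (ideal_pow I (m - 1)) J)) //; first by lia.
  exact: colon_ideal.
apply: ideal_add_min; first exact: colon_ideal.
  move=> a ha; apply: ideal_addl => //; exact: ideal_pow_mul_in.
by apply: subset_trans (colon_sub _ (hA m)); apply: ideal_addr; exact: ideal_pow_ideal.
Qed.

(** Split the lengths of R/A and R/B by multiplication by [x] and subtract. *)
Lemma len_mod_principal A B x : is_ideal A -> is_ideal B -> B `<=` A ->
  finite_length [set: R] B ->
  len A B = (len (ideal_add A (principal x)) (ideal_add B (principal x))
             + len (colon A x) (colon B x))%N.
Proof.
move=> hA hB sBA fB; have hx := principal_ideal x.
have fA : finite_length [set: R] A by apply: finite_lengthS fB.
have h1 := len_colon x hA fA; have h2 := len_colon x hB fB.
have h3 := len_add (idealT R) hA sBA (@subsetT _ A) fB.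
have sx : ideal_add B (principal x) `<=` ideal_add A (principal x) by exact: ideal_addSl.
have hAx := ideal_add_ideal hA hx; have hBx := ideal_add_ideal hB hx.
have fBx : finite_length [set: R] (ideal_add B (principal x)).
  by apply: finite_lengthS fB => //; exact: ideal_addl.
have h4 := len_add (idealT R) hAx sx (@subsetT _ _) fBx.
have sc : colon B x `<=` colon A x by exact: colonS.
have fBc : finite_length [set: R] (colon B x).
  by apply: finite_lengthS fB => //; exact: colon_sub.
have h5 := len_add (idealT R) (colon_ideal x hA) sc (@subsetT _ _) fBc.
lia.
Qed.

(* Modulo [J] one has [I^(N+k)] inside [(x^k)], and an element [b x^k] killed
   by [x] vanishes as soon as the annihilators of the powers of [x] are stable. *)
Lemma colon_cap_pow_eventually (hR : noetherian R) I J x (N : nat) : is_ideal J ->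
  (forall n : nat, (N <= n)%N ->
     ideal_pow I n.+1 `<=` ideal_mul (ideal_add J (principal x)) (ideal_pow I n)) ->
  exists N', forall n : nat, (N' <= n)%N ->
    colon J x `&` ideal_add (ideal_pow I n) J `<=` J.
Proof.
move=> hJ hred; have [J0 JD JM] := hJ.
have sI k : ideal_pow I (N + k)%N `<=` ideal_add J (principal (x ^+ k)).
  elim: k => [|k IH].
    by move=> a _; apply: ideal_addr => //; exists a => //; rewrite expr0 mulr1.
  rewrite addnS; apply: subset_trans (hred _ (leq_addr _ _)) _.
  apply: ideal_mul_min; first by apply: ideal_add_ideal => //; exact: principal_ideal.
  move=> _ a [j hj [_ [r _ <-] <-]] /IH[i hi [_ [b _ <-] <-]].
  exists (j * (i + b * x ^+ k) + r * x * i).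
    by apply: JD; [rewrite mulrC|]; exact: JM.
  by exists (r * b * x ^+ k.+1); [exists (r * b) | rewrite exprS; ring].
have [k|k a|k0 hk0] := noetherian_acc hR (L := fun k => colon J (x ^+ k)).
- exact: colon_ideal.
- by rewrite /colon /= exprS mulrCA; exact: JM.
exists (N + k0)%N => n hn a [hax [u hu [v hv e]]].
have := sI k0 u (ideal_pow_anti hn hu) => -[j hj [_ [b _ <-] eu]].
have ea : a = (j + v) + b * x ^+ k0 by rewrite -e -eu; ring.
have hjv : J (j + v) by exact: JD.
(* As [a * x] is in [J], [b] lies in J : x^(k0+1), hence by stability in J : x^k0, so the term
   [b * x ^+ k0] is in [J]. *)
rewrite ea; apply: JD => //; apply: (hk0 k0.+1); rewrite /colon /= exprS.
have -> : b * (x * x ^+ k0) = a * x - x * (j + v) by rewrite ea; ring.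
by apply: idealB => //; exact: JM.
Qed.

(** The colon meets I^n + J only in [J], so (J : x)/J embeds in R/(I^n + J). *)
Lemma finite_length_colon (I J : set R) x (n : nat) : is_ideal J ->
  colon J x `&` ideal_add (ideal_pow I n) J `<=` J ->
  finite_length [set: R] (ideal_add (ideal_pow I n) J) ->
  finite_length (colon J x) J.
Proof.
move=> hJ hs fin; have hI := ideal_pow_ideal I n.
have hA : is_ideal (ideal_add (ideal_pow I n) J) by exact: ideal_add_ideal.
have hc := colon_ideal x hJ.
have eJ : colon J x `&` ideal_add (ideal_pow I n) J = J.
  apply/seteqP; split=> // a ha; split; first exact: colon_sub.
  exact: ideal_addr.
have [k hk] : finite_length (ideal_add (colon J x) (ideal_add (ideal_pow I n) J))
    (ideal_add (ideal_pow I n) J).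
  apply: finite_lengthS fin => //; first exact: ideal_add_ideal.
  exact: ideal_addr.
by exists k; move/(is_length_setI k hc hA): hk; rewrite eJ.
Qed.

(** With B = Q I^n + J one has B + (x) = Q and B : x = (J : x) + I^n. Splitting the length of R/B by
    multiplication by [x], and that of R/(I^n + J) along (J : x) + I^n, brings in the intersection
    that becomes U. *)
Lemma len_last_step I J Q x (n : nat) : is_ideal J -> I x ->
  Q = ideal_add J (principal x) -> Q `<=` I ->
  finite_length [set: R] (ideal_add (ideal_mul Q (ideal_pow I n)) J) ->
  finite_length (colon J x) J ->
  (len (ideal_add (ideal_pow I n.+1) J)
       (ideal_add (ideal_mul Q (ideal_pow I n)) J)
   + len [set: R] (ideal_add (ideal_pow I n.+1) J) + len (colon J x) J =
   len [set: R] Q + len [set: R] (ideal_add (ideal_pow I n) J)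
   + len (colon J x `&` ideal_add (ideal_pow I n) J) J)%N.
Proof.
move=> hJ Ix eQ sQI fB fc; have hx := principal_ideal x.
have hI m := ideal_pow_ideal I m; have hc := colon_ideal x hJ.
have hQ : is_ideal Q by rewrite eQ; exact: ideal_add_ideal.
have hm : is_ideal (ideal_mul Q (ideal_pow I n)) by exact: ideal_mul_ideal.
have hA (k : nat) : is_ideal (ideal_add (ideal_pow I k) J) by exact: ideal_add_ideal.
set B := ideal_add _ J in fB *; have hB : is_ideal B by exact: ideal_add_ideal.
have sJQ : J `<=` Q by rewrite eQ; exact: ideal_addl.
have xQ : Q x by rewrite eQ; apply: ideal_addr => //; exact: principal_id.
have sBA : B `<=` ideal_add (ideal_pow I n.+1) J.
  by apply: ideal_addSl; apply: ideal_mulS.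
have h1 := len_add (idealT R) (hA n.+1) sBA (@subsetT _ _) fB.
have h2 := len_colon x hB fB.
have eB : ideal_add B (principal x) = Q.
  apply/seteqP; split.
    apply: ideal_add_min => //; last exact: principal_min.
    apply: ideal_add_min => //; apply: ideal_mul_min => // a b ha _.
    by rewrite mulrC; have [_ _] := hQ; exact.
  by rewrite eQ /B ideal_addA; apply: ideal_addr.
have hic : is_ideal (ideal_add (ideal_pow I n) (colon J x)) by exact: ideal_add_ideal.
have ec : colon B x = ideal_add (colon J x) (ideal_add (ideal_pow I n) J).
  rewrite -ideal_addA [ideal_add (colon J x) _]ideal_addC.
  rewrite (@ideal_add_id _ (ideal_add _ _)) //; last first.
    by apply: subset_trans (ideal_addr (hI n)); exact: colon_sub.
  apply/seteqP; split; last first.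
    apply: ideal_add_min; first exact: colon_ideal.
      move=> a ha; apply: ideal_addl => //=; rewrite mulrC; exact: ideal_mul_in.
    by apply: colonS; exact: ideal_addr.
  (* Modulo [J] the ideal [Q] is generated by [x], so Q I^n reduces to the multiples b x with b in
     I^n. *)
  have sm : B `<=` ideal_add [set b * x | b in ideal_pow I n] J.
    have hbx : is_ideal [set b * x | b in ideal_pow I n].
      have [i0 iD iM] := hI n; split.
      - by exists 0 => //; rewrite mul0r.
      - by move=> _ _ [a ha <-] [b hb <-]; exists (a + b); [exact: iD | rewrite mulrDl].
      - by move=> r _ [a ha <-]; exists (r * a); [exact: iM | rewrite mulrA].
    have hbJ := ideal_add_ideal hbx hJ.
    apply: ideal_add_min => //; last exact: ideal_addr.
    apply: ideal_mul_min => // a b; rewrite eQ => -[j hj [_ [r _ <-] <-]] hb.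
    exists (r * b * x); first by exists (r * b) => //; have [_ _] := hI n; exact.
    by exists (b * j); [have [_ _] := hJ; exact | ring].
  move=> a /sm [_ [b hb <-] [j hj e]]; exists b => //; exists (a - b); last by rewrite addrC subrK.
  by rewrite /colon /= mulrBl -e addrC addKr.
rewrite eB ec in h2.
have sAB : B `<=` ideal_add (ideal_pow I n) J.
  by apply: ideal_addSl; apply: ideal_mul_min => // a b _ hb; have [_ _] := hI n; exact.
have fA : finite_length [set: R] (ideal_add (ideal_pow I n) J).
  by apply: finite_lengthS fB.
have hcA : is_ideal (ideal_add (colon J x) (ideal_add (ideal_pow I n) J)).
  exact: ideal_add_ideal.
have h3 := len_add (idealT R) hcA (ideal_addr hc) (@subsetT _ _) fA.
have sJ : J `<=` colon J x `&` ideal_add (ideal_pow I n) J.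
  by move=> a ha; split; [exact: colon_sub | exact: ideal_addr].
have hcI := setI_ideal hc (hA n).
rewrite len_setI // in h3; last by apply: finite_lengthS fc.
have h4 := len_add hc hcI sJ (@subIsetl _ _ _) fc.
lia.
Qed.

End ColonLengths.

(** * Backward differences, Hilbert polynomials and summation by parts *)

Section BackwardDifferences.
Set Implicit Arguments.
Unset Strict Implicit.
Implicit Types (f g h : int -> int) (e : nat -> int) (m : int) (d i k n r N : nat).

Lemma backward_diffE f m : backward_diff f m = f m - f (m - 1).
Proof. by []. Qed.

(** The k-th difference at [m] sees only the [k + 1] values from m - k to m. *)
Lemma iter_backward_diff_local k f g m :
  (forall j : int, (m - k%:Z <= j <= m)%R -> f j = g j) ->
  iter k backward_diff f m = iter k backward_diff g m.
Proof.
elim: k m => [|k IH] m h; first by apply: h; lia.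
rewrite !iterS {1 3}/backward_diff.
by congr (_ - _); apply: IH => j hj; apply: h; lia.
Qed.

Lemma iter_backward_diffB k f g m :
  iter k backward_diff (fun j => f j - g j) m =
  iter k backward_diff f m - iter k backward_diff g m.
Proof.
elim: k m => [//|k IH] m; rewrite !iterS {1 3 5}/backward_diff !IH; ring.
Qed.

Lemma iter_backward_diff_cst k (c : int) m :
  iter k.+1 backward_diff (fun=> c) m = 0.
Proof.
elim: k m => [|k IH] m; first by rewrite /= /backward_diff subrr.
by rewrite iterS {1}/backward_diff !IH subrr.
Qed.

Lemma iter_backward_diff_eq0 k f m :
  (forall j : int, (m - k%:Z <= j <= m)%R -> f j = 0) ->
  iter k backward_diff f m = 0.
Proof.
move=> h; rewrite (iter_backward_diff_local (g := fun=> 0)) //.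
by case: k {h} => // k; exact: iter_backward_diff_cst.
Qed.

(* The polynomial [binomial (m + r - 1, r)] in [m], extended to negative [m]
   by [binomial (m + r - 1, r) = (-1)^r binomial (- m, r)]. *)
Definition bin_poly r m : int :=
  match m with
  | Posz n => 'C(n + r - 1, r)%:Z
  | Negz n => (-1) ^+ r * 'C(n.+1, r)%:Z
  end.

Lemma bin_poly0 m : bin_poly 0 m = 1.
Proof. by case: m => n; rewrite /bin_poly bin0. Qed.

Lemma bin_polyS0 r : bin_poly r.+1 0 = 0.
Proof. by rewrite -[0]/(Posz 0) /bin_poly bin_small //; lia. Qed.

(** Pascal's rule on either side of 0; the case m = 0, where the two formulas for [bin_poly] meet,
    is checked directly. *)
Lemma backward_diff_bin_poly r m :
  backward_diff (bin_poly r.+1) m = bin_poly r m.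
Proof.
rewrite /backward_diff; case: m => [[|n]|n].
- have -> : (Posz 0 - 1 = Negz 0)%R by [].
  rewrite bin_polyS0 /bin_poly; case: r => [|r]; first by rewrite !bin0 binn; ring.
  by rewrite !bin_small ?mulr0 //; lia.
- have -> : (Posz n.+1 - 1 = n)%R by lia.
  rewrite /bin_poly; have -> : (n.+1 + r.+1 - 1 = (n + r).+1)%N by lia.
  have -> : (n + r.+1 - 1 = n + r)%N by lia.
  have -> : (n.+1 + r - 1 = n + r)%N by lia.
  rewrite binS; lia.
- have -> : (Negz n - 1 = Negz n.+1)%R by lia.
  rewrite /bin_poly [in X in _ - X]binS PoszD exprS; ring.
Qed.

(** For r = d this is the Hilbert-Samuel polynomial; smaller [r] gives its (d - r)-th backward
    difference, which involves only e_0, ..., e_r. *)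
Definition hilbert_poly e r m : int :=
  \sum_(0 <= j < r.+1) (-1) ^+ j * e j * bin_poly (r - j) m.

Lemma hilbert_poly0 e m : hilbert_poly e 0 m = e 0%N.
Proof. by rewrite /hilbert_poly big_nat1 bin_poly0 expr0 mul1r mulr1. Qed.

(** At 0 every binomial of positive degree vanishes, so only the constant term survives. *)
Lemma hilbert_poly_at0 e r : hilbert_poly e r 0 = (-1) ^+ r * e r.
Proof.
rewrite /hilbert_poly big_nat_recr // subnn bin_poly0 mulr1 big_nat big1.
  exact: add0r.
move=> j /andP[_ jr]; have -> : (r - j = (r - j).-1.+1)%N by lia.
by rewrite bin_polyS0 mulr0.
Qed.

Lemma backward_diff_hilbert_poly e r m :
  backward_diff (hilbert_poly e r.+1) m = hilbert_poly e r m.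
Proof.
rewrite /backward_diff /hilbert_poly !(big_nat_recr r.+1) // subnn !bin_poly0.
rewrite opprD addrACA subrr addr0 -sumrB; apply: eq_big_nat => j /andP[_ jr].
rewrite -mulrBr; congr (_ * _); have -> : (r.+1 - j = (r - j).+1)%N by lia.
exact: backward_diff_bin_poly.
Qed.

Lemma iter_backward_diff_hilbert_poly e i r m :
  iter i backward_diff (hilbert_poly e (i + r)) m = hilbert_poly e r m.
Proof.
elim: i r m => [//|i IH] r m; rewrite iterS {1}/backward_diff addSnnS !IH.
exact: backward_diff_hilbert_poly.
Qed.

(** Repeated summation by parts: each round lowers both the binomial and the order of the difference
    by one, and the last sum telescopes. *)
Lemma sum_bin_backward_diff f r N k :
  (forall j : int, (N%:Z <= j)%R -> f j = 0) -> (N + r <= k)%N ->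
  \sum_(0 <= n < k) 'C(n, r)%:Z * iter r.+1 backward_diff f (n%:Z + 1)
  = (-1) ^+ r.+1 * f 0.
Proof.
move=> f0; elim: r k => [|r IH] k hk.
  rewrite (eq_bigr (fun n => f (Posz n.+1) - f (Posz n))) => [|n _].
    rewrite telescope_sumr // f0 ?sub0r; last by lia.
    by rewrite expr1 mulN1r.
  rewrite bin0 mul1r /= /backward_diff addrK; congr (f _ - _); lia.
set F := iter r.+1 backward_diff f.
(* The discrete product rule: a telescoping term minus the summand of order [r], by Pascal's
   rule. *)
have step n : 'C(n, r.+1)%:Z * iter r.+2 backward_diff f (n%:Z + 1)
    = ('C(n.+1, r.+1)%:Z * F (Posz n.+1) - 'C(n, r.+1)%:Z * F (Posz n))
      - 'C(n, r)%:Z * F (n%:Z + 1).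
  rewrite iterS -/F {1}/backward_diff addrK binS PoszD.
  have -> : (Posz n + 1 = Posz n.+1)%R by lia.
  by ring.
rewrite (eq_bigr _ (fun n _ => step n)) sumrB IH; last by lia.
rewrite (telescope_sumr (fun n => 'C(n, r.+1)%:Z * F (Posz n))) //.
(* Both boundary terms vanish: at [k] the difference reaches back only to k - r - 1, which is at
   least [N], and at 0 the binomial is 0. *)
have -> : F (Posz k) = 0 by apply: iter_backward_diff_eq0 => j hj; apply: f0; lia.
by rewrite (bin_small (ltn0Sn r)) mulr0 mul0r subrr sub0r [in RHS]exprS mulN1r mulNr.
Qed.

(** The strict bound forces n >= 1, where the differently truncated subtractions in the two
    binomials agree. *)
Lemma hilbert_function_poly h d e N n :
  (forall n, (N <= n)%N -> h n%:Z =
     \sum_(0 <= i < d.+1) (-1) ^+ i * e i * 'C(n + d - 1 - i, d - i)%:Z) ->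
  (N < n)%N -> h n%:Z = hilbert_poly e d n.
Proof.
move=> hN Nn; rewrite hN; last by lia.
apply: eq_big_nat => i hi; congr (_ * _); rewrite /bin_poly.
by congr ('C(_, _)%:Z); lia.
Qed.

Lemma hilbert_function_diff h d e N n :
  (forall n, (N <= n)%N -> h n%:Z =
     \sum_(0 <= i < d.+1) (-1) ^+ i * e i * 'C(n + d - 1 - i, d - i)%:Z) ->
  (N + d < n)%N -> iter d backward_diff h n%:Z = e 0%N.
Proof.
move=> hN Nn; rewrite (iter_backward_diff_local (g := hilbert_poly e d)).
  by rewrite -{2}(addn0 d) iter_backward_diff_hilbert_poly hilbert_poly0.
move=> j hj; have -> : j = Posz `|j|%N by lia.
by apply: hilbert_function_poly hN _; lia.
Qed.

(** Let g = P - h with P the Hilbert polynomial; it vanishes far out, and its d-th difference is e_0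
    minus that of [h]. Summation by parts applies to the (d - i)-th difference [G] of [g] and leaves
    its value at 0. *)
Lemma hilbert_coefficient_series h d e N i :
  (forall m, (m <= 0)%R -> h m = 0) ->
  (forall n, (N <= n)%N -> h n%:Z =
     \sum_(0 <= i < d.+1) (-1) ^+ i * e i * 'C(n + d - 1 - i, d - i)%:Z) ->
  (1 <= i <= d)%N ->
  int_series (i - 1)
    (fun n => 'C(n, i - 1)%:Z * (e 0%N - iter d backward_diff h (n%:Z + 1))) (e i).
Proof.
case: i => // i h0 hN hi; rewrite subn1 /=; pose g m := hilbert_poly e d m - h m.
pose G := iter (d - i.+1) backward_diff g.
have G0 (j : int) : ((N + d).+1%:Z <= j)%R -> G j = 0.
  move=> hj; apply: iter_backward_diff_eq0 => l hl.
  have -> : l = Posz `|l|%N by lia.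
  by rewrite /g (hilbert_function_poly hN) ?subrr //; lia.
exists (N + d + d).+1 => k hk.
(* At 0 the differences of [h] use only arguments at most 0, where [h] vanishes. What remains is the
   polynomial's value, whose sign cancels the prefactor. *)
have -> : e i.+1 = (-1) ^+ i.+1 * G 0.
  rewrite /G iter_backward_diffB [X in _ - X]iter_backward_diff_eq0 => [|j hj].
    have -> : hilbert_poly e d = hilbert_poly e ((d - i.+1) + i.+1).
      by congr hilbert_poly; lia.
    rewrite iter_backward_diff_hilbert_poly hilbert_poly_at0 subr0 mulrA -exprD.
    by rewrite -signr_odd oddD addbb expr0 mul1r.
  by apply: h0; lia.
rewrite -(@sum_bin_backward_diff G i (N + d).+1 k G0); last by lia.
(* The summation lemma starts at 0, the series at [i]; the terms in between have binomial 0. *)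
rewrite [RHS](big_cat_nat _ (n := i)) //=; last by lia.
rewrite [X in _ = X + _]big_nat [X in _ = X + _]big1 ?add0r; last first.
  by move=> n hn; rewrite bin_small ?mul0r //; lia.
apply: eq_bigr => n _; congr (_ * _).
rewrite -[backward_diff _]/(iter i.+1 backward_diff G) -iterD.
have -> : (i.+1 + (d - i.+1) = d)%N by lia.
rewrite iter_backward_diffB; have -> : hilbert_poly e d = hilbert_poly e (d + 0) by rewrite addn0.
by rewrite iter_backward_diff_hilbert_poly hilbert_poly0.
Qed.

End BackwardDifferences.

(** * The exact identity linking l, w, U and the Hilbert function *)

Section HilbertIdentity.
Set Implicit Arguments.
Unset Strict Implicit.
Local Open Scope classical_set_scope.
Variable R : comNzRingType.
Implicit Types (A B I J K : set R) (s : seq R) (m : int) (i j n : nat).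

Definition pow_mod I s i m := ideal_add (ideal_pow I m) (ideal_span (take i s)).

Definition quotient_len I s i m : int := (len [set: R] (pow_mod I s i m))%:Z.

Lemma pow_mod_ideal I s i m : is_ideal (pow_mod I s i m).
Proof. by apply: ideal_add_ideal; [exact: ideal_pow_ideal|exact: ideal_span_ideal]. Qed.

Lemma ideal_span_takeS s i : (i < size s)%N ->
  ideal_span (take i.+1 s) = ideal_add (ideal_span (take i s)) (principal s`_i).
Proof. by move=> hi; rewrite (take_nth 0) // ideal_span_rcons. Qed.

Lemma ideal_add_take0 I s : is_ideal I -> ideal_add I (ideal_span (take 0 s)) = I.
Proof.
move=> hI; rewrite take0; apply: ideal_add_id => //; first exact: ideal_span_ideal.
by rewrite ideal_span_nil => _ ->; have [] := hI.
Qed.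

Lemma quotient_len0 I s m :
  quotient_len I s 0 m = (len [set: R] (ideal_pow I m))%:Z.
Proof. by rewrite /quotient_len /pow_mod ideal_add_take0 //; exact: ideal_pow_ideal. Qed.

Lemma finite_length_pow_mod I s i m :
  (forall n J, is_ideal J -> ideal_pow I n `<=` J -> finite_length [set: R] J) ->
  finite_length [set: R] (pow_mod I s i m).
Proof.
move=> hfin; case: m => n; last apply: (hfin 0%N); first apply: (hfin n);
  by [exact: pow_mod_ideal | apply: ideal_addl; exact: ideal_span_ideal].
Qed.

Lemma quotient_lenS I s i m : (i < size s)%N -> ideal_span s `<=` I ->
  (forall n J, is_ideal J -> ideal_pow I n `<=` J -> finite_length [set: R] J) ->
  quotient_len I s i.+1 m =
    backward_diff (quotient_len I s i) m + colon_len I s i m.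
Proof.
move=> hi sI hfin; rewrite /quotient_len /pow_mod ideal_span_takeS //.
rewrite len_quotient_step //; first exact: ideal_span_ideal.
  by apply: sI; apply: ideal_span_in; exact: mem_nth.
by move=> k; exact: finite_length_pow_mod.
Qed.

(** Passing from i to i + 1 adds a new colon term and differences the earlier ones once more, hence
    the exponents [i - j]. *)
Lemma backward_diff_quotient_len I s i m : (i <= size s)%N -> ideal_span s `<=` I ->
  (forall n J, is_ideal J -> ideal_pow I n `<=` J -> finite_length [set: R] J) ->
  backward_diff (quotient_len I s i) m =
    iter i.+1 backward_diff (quotient_len I s 0) m
    + \sum_(0 <= j < i) iter (i - j) backward_diff (colon_len I s j) m.
Proof.
move=> + sI hfin; elim: i m => [|i IH] m hi; first by rewrite big_geq // addr0.
have {}IH k := IH k (ltnW hi).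
rewrite backward_diffE !quotient_lenS // !IH big_nat_recr // subSnn.
have -> : \sum_(0 <= j < i) iter (i.+1 - j) backward_diff (colon_len I s j) m =
  \sum_(0 <= j < i) (iter (i - j) backward_diff (colon_len I s j) m
   - iter (i - j) backward_diff (colon_len I s j) (m - 1)).
  by apply: eq_big_nat => j /andP[_ hj]; rewrite subSn ?(ltnW hj) // iterS.
by rewrite sumrB /= (backward_diffE (backward_diff _)) (backward_diffE (colon_len _ _ _)); ring.
Qed.

(** The length of l(n) after reduction modulo x_1, ..., x_i; for i = 0 it is [l_len]. *)
Definition l_mod I s i n : nat :=
  len (pow_mod I s i n.+1)
      (ideal_add (ideal_mul (ideal_span s) (ideal_pow I n)) (ideal_span (take i s))).

(** The length subtracted in the i-th summand of [w]. *)
Definition colon_defect I s i n : nat :=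
  len (colon (pow_mod I s i n.+1) s`_i)
      (colon (ideal_add (ideal_mul (ideal_span s) (ideal_pow I n))
                        (ideal_span (take i s))) s`_i).

(** By [len_mod_principal], factoring out one more x_(j+1) loses exactly [colon_defect] at j. *)
Lemma l_mod_sum I s i n : (i <= size s)%N -> ideal_span s `<=` I ->
  finite_length [set: R] (ideal_mul (ideal_span s) (ideal_pow I n)) ->
  l_mod I s 0 n = (l_mod I s i n + \sum_(0 <= j < i) colon_defect I s j n)%N.
Proof.
move=> + sI fB; elim: i => [|i IH] hi; first by rewrite big_geq // addn0.
rewrite IH; last exact: ltnW.
rewrite big_nat_recr //= [RHS]addnCA [LHS]addnC; congr addn.
rewrite /l_mod /colon_defect /pow_mod ideal_span_takeS // -!ideal_addA.
have hS := ideal_span_ideal (take i s).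
apply: len_mod_principal.
- exact: pow_mod_ideal.
- by apply: ideal_add_ideal => //; exact: ideal_mul_ideal.
- by apply: ideal_addSl; exact: ideal_mulS.
- apply: finite_lengthS fB => //; exact: ideal_addl.
Qed.

(** In l + w the colon defects cancel, and the differenced colon lengths turn the first difference
    at level d - 1 into the d-th difference at level 0. The last element x_d contributes U and the
    constant. *)
Lemma l_w_U_identity I s n : (0 < size s)%N -> ideal_span s `<=` I ->
  let Q' := ideal_span (take (size s).-1 s) in
  (forall n J, is_ideal J -> ideal_pow I n `<=` J -> finite_length [set: R] J) ->
  finite_length [set: R] (ideal_mul (ideal_span s) (ideal_pow I n)) ->
  finite_length (colon Q' s`_(size s).-1) Q' ->
  (l_len I s n)%:Z + w I s n - (U_len I s n)%:Z =
  (len [set: R] (ideal_span s))%:Z - (len (colon Q' s`_(size s).-1) Q')%:Z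
  - iter (size s) backward_diff (fun m => (len [set: R] (ideal_pow I m))%:Z) (n%:Z + 1).
Proof.
move=> s0 sI Q' hfin fB fc; set p := (size s).-1.
have es : size s = p.+1 by rewrite /p prednK.
have eQ : ideal_span s = ideal_add Q' (principal s`_p).
  by rewrite -{1}(take_size s) es ideal_span_takeS // es.
have e1 : (n%:Z + 1 = Posz n.+1)%R by lia.
have hQ' : is_ideal Q' by exact: ideal_span_ideal.
have el : l_len I s n = l_mod I s 0 n.
  rewrite /l_len /l_mod /pow_mod !ideal_add_take0 ?e1 //.
  - exact: ideal_mul_ideal.
  - exact: ideal_pow_ideal.
have -> : (fun m => (len [set: R] (ideal_pow I m))%:Z) = quotient_len I s 0.
  by apply: funext => m; rewrite quotient_len0.
have h1 := @backward_diff_quotient_len I s p (n%:Z + 1) _ sI hfin.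
have h2 := @l_mod_sum I s p n _ sI fB.
have Ix : I s`_p by apply: sI; apply: ideal_span_in; apply: mem_nth; rewrite es.
have fB' : finite_length [set: R] (ideal_add (ideal_mul (ideal_span s) (ideal_pow I n)) Q').
  by apply: finite_lengthS fB => //; exact: ideal_addl.
have h3 := len_last_step hQ' Ix eQ sI fB' fc.
have ew : w I s n = \sum_(0 <= j < p) iter (p - j) backward_diff (colon_len I s j) (n%:Z + 1)
    - (\sum_(0 <= j < p) colon_defect I s j n)%N%:Z.
  rewrite [X in _ - X](big_morph Posz PoszD (erefl _)) -sumrB.
  by apply: eq_bigr => j _; rewrite /colon_defect /pow_mod e1.
have eH k : (len [set: R] (ideal_add (ideal_pow I k) Q'))%:Z = quotient_len I s p k by [].
have eU : U_len I s n = len (colon Q' s`_p `&` ideal_add (ideal_pow I n) Q') Q' by [].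
have el' : l_mod I s p n = len (ideal_add (ideal_pow I n.+1) Q')
    (ideal_add (ideal_mul (ideal_span s) (ideal_pow I n)) Q') by [].
rewrite ew el {}h2 -?el' -?eU in h3 *; last by rewrite es.
move: (h1 (leq_pred _)); rewrite -es backward_diffE addrK e1 -!eH => {}h1.
lia.
Qed.

End HilbertIdentity.

(** * Behaviour for large n: reductions, colon lengths and w *)

Section Eventually.
Set Implicit Arguments.
Unset Strict Implicit.
Local Open Scope classical_set_scope.
Variable R : comNzRingType.
Implicit Types (I J M Q : set R) (s : seq R) (j n : nat).

Lemma eventually_all (P : nat -> nat -> Prop) p :
  (forall j, (j < p)%N -> exists N, forall n, (N <= n)%N -> P j n) ->
  exists N, forall n, (N <= n)%N -> forall j, (j < p)%N -> P j n.
Proof.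
elim: p => [|p IH] h; first by exists 0%N.
have [N hN] := IH (fun j hj => h j (ltnW hj)); have [N' hN'] := h p (leqnn _).
exists (maxn N N') => n; rewrite geq_max => /andP[hn hn'] j.
by rewrite ltnS leq_eqVlt => /orP[/eqP->|hj]; [exact: hN' | exact: hN].
Qed.

Lemma reduction_eventually I Q n0 : Q `<=` I ->
  ideal_mul Q (ideal_pow I n0) = ideal_pow I n0.+1 ->
  forall n, (n0 <= n)%N -> ideal_mul Q (ideal_pow I n) = ideal_pow I n.+1.
Proof.
move=> sQI h n /subnK <-; elim: (n - n0)%N => // k IH.
rewrite addSn; set m := (k + n0)%N in IH *.
apply/seteqP; split; first by apply: ideal_mulS.
rewrite (ideal_powS I m.+1) -{1}IH.
by apply: ideal_mulCA; exact: ideal_pow_ideal.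
Qed.

(** If b^k is in I then b^(kn) is in I^n, so [finite_length_primary] applies. *)
Lemma finite_length_pow (hR : noetherian R) M I : maximal_ideal M -> radical I = M ->
  forall n J, is_ideal J -> ideal_pow I n `<=` J -> finite_length [set: R] J.
Proof.
move=> hM eM n J hJ sJ; apply: (finite_length_primary hR hM hJ) => b.
rewrite -eM => -[k hk]; exists (k * n)%N; rewrite exprM; apply: sJ.
exact: ideal_pow_exp.
Qed.

Lemma colon_len_eventually_constant I s j :
  (forall n J, is_ideal J -> ideal_pow I n `<=` J -> finite_length [set: R] J) ->
  superficial_seq I s -> (j < size s)%N ->
  exists N v, forall m : int, (N%:Z < m)%R -> colon_len I s j m = v.
Proof.
move=> hfin [h0 hs] hj; set J := ideal_span (take j s).
have hJ : is_ideal J by exact: ideal_span_ideal.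
have [c hc] : exists c : nat, forall n : nat, (c <= n)%N ->
    colon (ideal_add (ideal_pow I n.+1) J) s`_j `&` ideal_add (ideal_pow I c) J
    = ideal_add (ideal_pow I n) J.
  case: (posnP j) => j0; last by apply: superficial_mod_colon; apply: hs; rewrite j0.
  rewrite /J j0 take0 ideal_span_nil; apply: superficial_colon; apply: h0.
  by apply: leq_ltn_trans hj.
have [|N [v hN]] := superficial_colon_len hJ _ hc.
  by apply: (hfin c); [apply: ideal_add_ideal => //; exact: ideal_pow_ideal | exact: ideal_addl].
exists N, v%:Z => m hm; rewrite -(hN `|m - 1|%N); last by lia.
rewrite /colon_len -/J; have <- : (m - 1 = Posz `|m - 1|%N)%R by lia.
by have -> : Posz `|m - 1|.+1 = m by lia.
Qed.

(** Each colon length is eventually constant and is differenced at least once; each defect vanishes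
    once Q I^n = I^(n+1). *)
Lemma w_eventually0 I s n0 : superficial_seq I s ->
  (forall n J, is_ideal J -> ideal_pow I n `<=` J -> finite_length [set: R] J) ->
  (forall n, (n0 <= n)%N ->
    ideal_mul (ideal_span s) (ideal_pow I n) = ideal_pow I n.+1) ->
  exists N, forall n, (N <= n)%N -> w I s n = 0.
Proof.
move=> hs hfin hred; set p := (size s).-1.
have [j hj|N hN] := @eventually_all (fun j n =>
    iter (p - j) backward_diff (colon_len I s j) (n%:Z + 1) = 0) p.
  have [|N [v hv]] := colon_len_eventually_constant hfin hs (j := j); first by lia.
  exists (N + p)%N => n hn.
  rewrite (iter_backward_diff_local (g := fun=> v)) => [|m hm]; last by apply: hv; lia.
  have -> : (p - j = (p - j).-1.+1)%N by lia.
  exact: iter_backward_diff_cst.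
exists (maxn N n0) => n; rewrite geq_max => /andP[hn hn0].
rewrite /w -/p big_nat big1 // => j /andP[_ hj]; cbv zeta; rewrite hN // sub0r.
have -> : (n%:Z + 1 = Posz n.+1)%R by lia.
rewrite hred // len_id //; apply: colon_ideal; exact: pow_mod_ideal.
Qed.

End Eventually.

(** * Identification of the constant with e_0, and extraction of e_i *)

Theorem corollary2p12 (R : comNzRingType) (M I : set R) (d delta : nat)
    (x : d.-tuple R) (e : nat -> int)
    (hnoeth : noetherian R)
    (hlocal : local_ring M)
    (hdim : is_krull_dim R d)
    (hd : (1 <= d)%N)
    (hres : infinite_residue_field M)
    (hdepth : is_depth M delta)
    (hdelta : (d - 1 <= delta)%N)
    (hI : m_primary M I)
    (hQ : minimal_reduction I (ideal_span x))
    (hx : superficial_seq I x)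
    (he : hilbert_coefficients I d e) :
  forall i : nat, (1 <= i <= d)%N ->
    int_series (i - 1)
      (fun n => 'C(n, i - 1)%:Z *
                ((l_len I x n)%:Z + w I x n - (U_len I x n)%:Z))
      (e i).
Proof.
have hfin := finite_length_pow hnoeth hlocal.1 hI.2.
have [[_ sQI [n0 hn0]] _] := hQ.
have hred := reduction_eventually sQI hn0.
have sx : size x = d by exact: size_tuple.
(* Q I^n contains Q I^(n+n0) = I^(n+n0+1), a power of I. *)
have fB (n : nat) : finite_length [set: R]%classic (ideal_mul (ideal_span x) (ideal_pow I n)).
  apply: (hfin (n + n0).+1); first exact: ideal_mul_ideal.
  rewrite -hred ?leq_addl //; apply: ideal_mulS => //.
  by apply: ideal_pow_anti; exact: leq_addr.
set Q' := ideal_span (take (size x).-1 x).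
have hQ' : is_ideal Q' by exact: ideal_span_ideal.
have eQ : ideal_span x = ideal_add Q' (principal x`_(size x).-1).
  have x0 : (0 < size x)%N by rewrite sx.
  by rewrite -ideal_span_takeS prednK // take_size.
have [|N1 hN1] := colon_cap_pow_eventually hnoeth (I := I) (J := Q')
    (x := x`_(size x).-1) (N := n0) hQ'.
  by move=> n hn; rewrite -eQ hred.
have fc : finite_length (colon Q' x`_(size x).-1) Q'.
  apply: (finite_length_colon hQ' (hN1 N1 (leqnn _))).
  apply: (hfin N1); last exact: ideal_addl.
  by apply: ideal_add_ideal => //; exact: ideal_pow_ideal.
have key (n : nat) := l_w_U_identity (_ : 0 < size x)%N sQI hfin (fB n) fc.
have [N2 hN2] := w_eventually0 hx hfin hred.
have [N3 hN3] := he.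
set h := fun m : int => (len [set: R]%classic (ideal_pow I m))%:Z in key.
have h0 (m : int) : (m <= 0)%R -> h m = 0.
  by move=> hm; rewrite /h ideal_pow_le0 // len_id.
have {}key (n : nat) : (l_len I x n)%:Z + w I x n - (U_len I x n)%:Z
    = e 0%N - iter d backward_diff h (n%:Z + 1).
  have x0 : (0 < size x)%N by rewrite sx.
  rewrite key // sx; congr (_ - _); rewrite -/Q'.
  (* Past all thresholds l, w and U vanish; the extra [d] leaves room for the d-th difference to
     stay in the polynomial range. Evaluating the identity at this [m] gives the constant. *)
  pose m := (n0 + N1 + N2 + N3 + d)%N.
  have l0 : l_len I x m = 0%N.
    rewrite /l_len; have -> : (m%:Z + 1 = Posz m.+1)%R by lia.
    rewrite hred; last by lia.
    by apply: len_id; exact: (ideal_pow_ideal I m.+1).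
  have U0 : U_len I x m = 0%N.
    rewrite /U_len -/Q'.
    suff -> : (colon Q' x`_(size x).-1 `&` ideal_add (ideal_pow I m) Q' = Q')%classic.
      exact: len_id.
    apply/seteqP; split; first by apply: (hN1 m); lia.
    move=> a ha; split; first exact: (colon_sub _ hQ' ha).
    exact: (ideal_addr (ideal_pow_ideal I m) ha).
  have := key x0 m; rewrite l0 U0 hN2; last by lia.
  rewrite sx -/Q'; have -> : (m%:Z + 1 = Posz m.+1)%R by lia.
  rewrite (@hilbert_function_diff h d e N3) //; last by lia.
  lia.
move=> i hi; have [N hN] := hilbert_coefficient_series h0 hN3 hi.
by exists N => k /hN <-; apply: eq_bigr => n _; rewrite key.
Qed.
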